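(* Let $f(X)\in\mathbb{Z}[X]$ be a polynomial of degree $n\geq 1$ with $f(0)\neq 0$, let $k\geq 2$, let $p_{1},\dots ,p_{k}$ be pairwise distinct prime numbers, and for $i=1,\dots ,k$ let $d_{p_{i}}$ denote the greatest common divisor of the widths of the segments of the Newton polygon of $f$ with respect to $p_{i}$. Then the degree of any factor of $f$ is divisible by $n/\gcd\left(\frac{n}{d_{p_{1}}},\dots ,\frac{n}{d_{p_{k}}}\right)$. In particular, if $\gcd\left(\frac{n}{d_{p_{1}}},\dots ,\frac{n}{d_{p_{k}}}\right)=1$, then $f$ is irreducible over $\mathbb{Q}$.
   Context: For a prime $p$ and a nonzero integer $m$, $\nu_p(m)$ is the largest integer $i$ with $p^i\mid m$; $\nu_p(0)=\infty$. For $f(X)=\sum_{i=0}^n a_iX^i\in\mathbb{Z}[X]$ with $a_0a_n\neq 0$, the Newton polygon of $f$ with respect to $p$ is the lower convex hull of the points $(i,\nu_p(a_i))$, $0\le i\le n$, $a_i\neq 0$: a broken line from $(0,\nu_p(a_0))$ to $(n,\nu_p(a_n))$. Its vertices $A_0,\dots,A_m$ are the corner points (including the two end-points), and the edges are the pieces $A_jA_{j+1}$; the slopes of the edges strictly increase from left to right. All points with integer coordinates lying on the broken line subdivide it into segments: a segment is a piece of the broken line joining two consecutive points with integer coordinates on it (so a segment contains no points with integer coordinates other than its end-points, and each edge is composed of one or more segments). The width of a segment is the length of its projection onto the $x$-axis. *)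

(* Defs.v *)
From mathcomp Require Import all_boot all_order all_algebra.
From mathcomp Require Import boolp classical_sets reals convex.

Set Implicit Arguments.
Unset Strict Implicit.
Unset Printing Implicit Defensive.

Import Order.TTheory GRing.Theory Num.Theory.

Local Open Scope classical_set_scope.
Local Open Scope ring_scope.

Definition plane (R : realType) : Type := (R^o * R^o)%type.

Definition convex_hull (R : realType) (A : set (plane R)) : set (plane R) :=
  smallest (@convex_set R (R^o * R^o)%type) A.

Definition lower_boundary (R : realType) (A : set (plane R)) : set (plane R) :=
  [set P | A P /\ forall Q, A Q -> Q.1 = P.1 -> P.2 <= Q.2].

(* [logn p m] is the p-adic valuation of m when p is prime and m <> 0; zero
   coefficients, of infinite valuation, contribute no point. *)
Definition newton_points (R : realType) (p : nat) (f : {poly int}) :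
    set (plane R) :=
  [set ((i%:R : R^o), ((logn p (absz f`_i))%:R : R^o)) | i in [set i | f`_i != 0]].

Definition newton_polygon (R : realType) (p : nat) (f : {poly int}) :
    set (plane R) :=
  lower_boundary (convex_hull (newton_points p f)).

Definition lattice_point (R : realType) (A : int * int) : plane R :=
  (A.1%:~R, A.2%:~R).

(* The polygon is the graph of a function, so that the order of its points
   along the broken line is the order of their abscissae. *)
Definition newton_segment (R : realType) (p : nat) (f : {poly int})
    (A B : int * int) : Prop :=
  [/\ newton_polygon p f (lattice_point R A),
      newton_polygon p f (lattice_point R B),
      A.1 < B.1
    & forall C : int * int, newton_polygon p f (lattice_point R C) ->
        ~ (A.1 < C.1 < B.1)].

Definition segment_width (A B : int * int) : nat := `|B.1 - A.1|%N.

(* The range loses no width: the polygon lies above [0, (size f).-1]. *)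
Definition width_gcd (R : realType) (p : nat) (f : {poly int}) : nat :=
  \big[gcdn/0%N]_(w < size f |
    `[< exists A B, newton_segment R p f A B /\ w = segment_width A B :> nat >])
    w.

(* Main.v *)
Require Import Defs.
From mathcomp Require Import all_boot all_order all_algebra.
From mathcomp Require Import boolp classical_sets reals convex.
From mathcomp Require Import interval_inference.
From mathcomp Require Import zify ring lra.

(* For a slope a/b in lowest terms, give the point (i, v) the height b v - a i.
   The lowest points among those of f lie on a line of slope a/b; if there are
   two of them, the polygon contains the segment joining them, whose lattice
   points are b apart, so that b is the width of a segment and the gcd d of the
   widths divides b. As in Gauss's lemma, the sum of the leftmost (rightmost)
   lowest indices of g and h is a lowest index of g h. Hence if g has two lowest
   points, so has f = g h, and the corresponding b divides the length of the
   edge of g. Adding up the edges of g, d divides deg g. Thus n divides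
   deg g * (n / d) for each prime, hence deg g * D. *)

Set Implicit Arguments.
Unset Strict Implicit.
Unset Printing Implicit Defensive.

Import Order.TTheory GRing.Theory Num.Theory.
Local Open Scope ring_scope.

(** * Points of minimal height for a given slope *)

Definition height (p : nat) (a b : int) (f : {poly int}) (i : nat) : int :=
  b * (logn p `|f`_i|)%:Z - a * i%:Z.

Definition lowest (p : nat) (a b : int) (f : {poly int}) (i : nat) : Prop :=
  f`_i != 0 /\
  forall j, f`_j != 0 -> height p a b f i <= height p a b f j.

Lemma coef_neq0_lt_size (f : {poly int}) (i : nat) : f`_i != 0 -> (i < size f)%N.
Proof. by apply: contraR; rewrite -leqNgt => ?; rewrite nth_default. Qed.

Lemma lowest_height (p : nat) (a b : int) (f : {poly int}) (i j : nat) :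
  lowest p a b f i -> lowest p a b f j -> height p a b f i = height p a b f j.
Proof. by move=> [fi mi] [fj mj]; apply/eqP; rewrite eq_le mi ?mj. Qed.

(** Equal heights give [b * (v k - v i) = a * (k - i)], with [v] the valuation of the coefficient,
    and [b] is coprime to [a]. *)
Lemma dvdz_edge (p : nat) (a b : int) (f : {poly int}) (i k : nat) :
  coprimez a b -> lowest p a b f i -> lowest p a b f k ->
  (b %| k%:Z - i%:Z)%Z.
Proof.
move=> co_ab low_i low_k.
rewrite -(Gauss_dvdzr _ (_ : coprimez b a)) 1?coprimez_sym //.
apply/dvdzP; exists ((logn p `|f`_k|)%:Z - (logn p `|f`_i|)%:Z).
by have := lowest_height low_i low_k; rewrite /height; lia.
Qed.

(** * Edges of the Newton polygon *)

Lemma convex_hull_above (R : realType) (a b c : R) (A : set (plane R)) :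
  (forall P, A P -> c <= b * P.2 - a * P.1) ->
  forall P, convex_hull A P -> c <= b * P.2 - a * P.1.
Proof.
(* The half-plane [H] is convex and contains [A], hence the hull. *)
move=> Ac; pose H : set (plane R) := [set P | c <= b * P.2 - a * P.1]%classic.
suff: (convex_hull A `<=` H)%classic by [].
apply: smallest_sub => // -[x1 y1] [x2 y2] t /set_mem/= H1 /set_mem/= H2.
apply/mem_set.
change (c <= b * (t%:inum * y1 + (1 - t%:inum) * y2)
             - a * (t%:inum * x1 + (1 - t%:inum) * x2)).
have t0 : 0 <= t%:inum by [].
have t1 : t%:inum <= 1 by [].
rewrite /H /= in H1 H2; nra.
Qed.

Lemma convex_hull_conv (R : realType) (A : set (plane R)) (t : R) (P Q : plane R) :
  0 <= t <= 1 -> A P -> A Q ->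
  convex_hull A (t * P.1 + (1 - t) * Q.1, t * P.2 + (1 - t) * Q.2).
Proof.
move=> t01 AP AQ M /= [cM AM].
have [t0 t1] := andP t01.
have := cM P Q (Itv01 t0 t1) (mem_set (AM _ AP)) (mem_set (AM _ AQ)).
by move/set_mem.
Qed.

Lemma mem_newton_points (R : realType) (p : nat) (f : {poly int}) (i : nat) :
  f`_i != 0 -> newton_points p f ((i%:R, (logn p `|f`_i|)%:R) : plane R).
Proof. by move=> fi; exists i. Qed.

Lemma dvdz_le (d m : int) : 0 < m -> (d %| m)%Z -> d <= m.
Proof. by move=> m_gt0; rewrite dvdzE => /dvdn_leq; lia. Qed.

Section Edge.
Variables (R : realType) (p : nat) (f : {poly int}) (a b : int) (i k : nat).
Hypotheses (b_gt0 : 0 < b) (lt_ik : (i < k)%N).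
Hypotheses (low_i : lowest p a b f i) (low_k : lowest p a b f k).

(** The line through the two lowest points supports the hull from below, and between them it
    consists of their convex combinations, which belong to the hull. *)
Lemma newton_polygon_edge (P : plane R) :
  i%:R <= P.1 <= k%:R ->
  newton_polygon p f P <->
  b%:~R * P.2 - a%:~R * P.1 = (height p a b f i)%:~R.
Proof.
case: P => x y /= /andP[ix xk].
have bR : 0 < b%:~R :> R by rewrite ltr0z.
have ikR : 0 < k%:R - i%:R :> R by rewrite subr_gt0 ltr_nat.
have heightE j : (height p a b f j)%:~R =
    b%:~R * (logn p `|f`_j|)%:R - a%:~R * j%:R :> R.
  by rewrite /height intrB !intrM -!pmulrn.
have above (Q : plane R) : convex_hull (newton_points p f) Q ->
    (height p a b f i)%:~R <= b%:~R * Q.2 - a%:~R * Q.1.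
  apply: convex_hull_above => _ [j fj <-] /=.
  by have := low_i.2 _ fj; rewrite -(ler_int R) !heightE.
pose z : R := ((height p a b f i)%:~R + a%:~R * x) / b%:~R.
have zE : b%:~R * z - a%:~R * x = (height p a b f i)%:~R.
  by rewrite /z; field; rewrite gt_eqF.
have hull_z : convex_hull (newton_points p f) (x, z).
  (* The barycentric weight of the left end-point at abscissa [x]. *)
  pose t : R := (k%:R - x) / (k%:R - i%:R).
  have t01 : 0 <= t <= 1.
    apply/andP; split; last by rewrite ler_pdivrMr // mul1r; lra.
    by apply: divr_ge0; [rewrite subr_ge0 | exact: ltW].
  have tE : t * i%:R + (1 - t) * k%:R = x by rewrite /t; field; rewrite gt_eqF.
  have := convex_hull_conv t01
    (mem_newton_points R p low_i.1) (mem_newton_points R p low_k.1).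
  congr (convex_hull _ (_, _)) => //=.
  apply: (mulfI (lt0r_neq0 bR)); apply: (addIr (- (a%:~R * x))); rewrite zE.
  have := congr1 (intr : int -> R) (lowest_height low_k low_i); rewrite heightE => hk.
  rewrite -tE; transitivity ((1 - t) * (height p a b f i)%:~R +
                             t * (height p a b f i)%:~R); last by ring.
  by rewrite -{1}hk heightE; ring.
split=> [[hy /(_ (x, z) hull_z erefl) /= yz] | yE].
  apply/eqP; rewrite eq_le (above (x, y)) // andbT -zE lerD2r ler_pM2l //.
have -> : y = z.
  by apply: (mulfI (lt0r_neq0 bR)); apply: (addIr (- (a%:~R * x))); rewrite yE zE.
split=> // -[x' y'] /above /= xy' xE; rewrite xE -zE in xy' *.
by rewrite -(ler_pM2l bR); lra.
Qed.

Lemma width_gcd_edge : coprimez a b -> (width_gcd R p f %| `|b|)%N.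
Proof.
move=> co_ab.
pose v j := (logn p `|f`_j|)%:Z.
have b_ik : (b %| k%:Z - i%:Z)%Z by exact: dvdz_edge low_i low_k.
have le_b : b <= k%:Z - i%:Z by apply: dvdz_le b_ik; lia.
have lt_kf := coef_neq0_lt_size low_k.1.
(* As [b <= k - i < size f], the width lies in the range of the gcd. *)
have lt_bf : (`|b| < size f)%N by lia.
apply: (@biggcdn_inf _ (Ordinal lt_bf)) => //; apply/asboolP.
have polyE (C : int * int) : i%:Z <= C.1 <= k%:Z ->
    newton_polygon p f (lattice_point R C) <-> b * (C.2 - v i) = a * (C.1 - i%:Z).
  case: C => x y /= /andP[ix xk].
  rewrite newton_polygon_edge /=; last by rewrite !pmulrn !ler_int ix.
  rewrite -!intrM -intrB; split=> [/intr_inj|yE]; rewrite /height -/(v i); first by lia.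
  by congr (_%:~R); lia.
(* Since [a] and [b] are coprime, [(b, a)] is the shortest lattice vector along the edge. *)
exists (i%:Z, v i), (i%:Z + b, v i + a); split; last by rewrite /segment_width /=; lia.
split=> [|||C pC /= /andP[iC Cb]]; rewrite ?polyE /=; try lia.
have : (b %| C.1 - i%:Z)%Z.
  rewrite -(Gauss_dvdzr _ (_ : coprimez b a)) 1?coprimez_sym //.
  by rewrite -(polyE C _).1 ?dvdz_mulr //; lia.
by move/dvdz_le; lia.
Qed.
End Edge.

(** * Valuations of sums and lowest points of products *)

Lemma dvdz_pfactor (p e : nat) (m : int) :
  prime p -> m != 0 -> ((p ^ e)%N%:Z %| m)%Z = (e <= logn p `|m|)%N.
Proof. by move=> p_pr m0; rewrite dvdzE /= pfactor_dvdn // absz_gt0. Qed.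

Lemma dvdz_sum (I : Type) (r : seq I) (P : pred I) (F : I -> int) (d : int) :
  (forall i, P i -> (d %| F i)%Z) -> (d %| \sum_(i <- r | P i) F i)%Z.
Proof. by move=> dF; apply: rpred_sum => i /dF. Qed.

(** Otherwise [p ^ e.+1] would divide every term, hence the sum. *)
Lemma logn_sum_ge (p : nat) (I : finType) (F : I -> int) :
  prime p -> \sum_i F i != 0 ->
  exists2 i, F i != 0 & (logn p `|F i| <= logn p `|(\sum_i F i)%R|)%N.
Proof.
move=> p_pr sum0; set e := logn p `|(\sum_i F i)%R|.
apply/exists_inP; apply: contraT; rewrite negb_exists_in => /forall_inP noF.
suff : ((p ^ e.+1)%N%:Z %| \sum_i F i)%Z by rewrite dvdz_pfactor // ltnn.
apply: dvdz_sum => i _; have [->|Fi] := eqVneq (F i) 0; first exact: dvdz0.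
by rewrite dvdz_pfactor // ltnNge noF.
Qed.

(** Modulo [p ^ e.+1] only the term [F i] survives. *)
Lemma logn_sum_eq (p : nat) (I : finType) (F : I -> int) (i : I) :
  prime p -> F i != 0 ->
  (forall j, j != i -> F j != 0 -> (logn p `|F i| < logn p `|F j|)%N) ->
  \sum_j F j != 0 /\ logn p `|(\sum_j F j)%R| = logn p `|F i|.
Proof.
move=> p_pr Fi Fj; set e := logn p `|F i| in Fj *.
have rest : ((p ^ e.+1)%N%:Z %| \sum_(j | j != i) F j)%Z.
  apply: dvdz_sum => j ji; have [->|nz] := eqVneq (F j) 0; first exact: dvdz0.
  by rewrite dvdz_pfactor // Fj.
have rest' : ((p ^ e)%N%:Z %| \sum_(j | j != i) F j)%Z.
  by apply: dvdz_trans rest; rewrite dvdzE /= dvdn_exp2l.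
have not_dvd : ~~ ((p ^ e.+1)%N%:Z %| \sum_j F j)%Z.
  by rewrite (bigD1 i) //= rpredDr // dvdz_pfactor // ltnn.
have sum0 : \sum_j F j != 0 by apply: contraNneq not_dvd => ->; exact: dvdz0.
split=> //; apply/eqP; rewrite eqn_leq -ltnS ltnNge -dvdz_pfactor // not_dvd /=.
by rewrite -dvdz_pfactor // (bigD1 i) //= rpredDr // dvdz_pfactor.
Qed.

(** The last summand depends only on [i + j], so among the terms of one coefficient of [g * h],
    comparing valuations amounts to comparing sums of heights. *)
Lemma logn_coefM (p : nat) (a b : int) (g h : {poly int}) (i j : nat) :
  g`_i * h`_j != 0 ->
  b * (logn p `|(g`_i * h`_j)%R|)%:Z =
  height p a b g i + height p a b h j + a * (i + j)%:Z.
Proof.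
rewrite mulf_eq0 negb_or => /andP[gi hj].
by rewrite abszM lognM ?absz_gt0 // /height; lia.
Qed.

Section Product.
Variables (p : nat) (a b : int) (g h : {poly int}) (i j : nat).
Hypotheses (p_pr : prime p) (b_gt0 : 0 < b).
Hypotheses (low_i : lowest p a b g i) (low_j : lowest p a b h j).

Lemma height_mul_ge (s : nat) : (g * h)`_s != 0 ->
  height p a b g i + height p a b h j <= height p a b (g * h) s.
Proof.
rewrite [X in _ <= X]/height => gh0.
have [t nz] : exists2 t : 'I_s.+1, g`_t * h`_(s - t) != 0 &
    (logn p `|(g`_t * h`_(s - t))%R| <= logn p `|((g * h)`_s)%R|)%N.
  by rewrite coefM in gh0 *; exact: logn_sum_ge.
move: (logn p `|((g * h)`_s)%R|) => e le_e.
have := logn_coefM p a b nz; rewrite subnKC; last by rewrite -ltnS.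
move: nz le_e; rewrite mulf_eq0 negb_or => /andP[gt ht].
have le_h := lerD (low_i.2 _ gt) (low_j.2 _ ht).
rewrite -lez_nat -(ler_pM2l b_gt0) => le_e E.
by rewrite lerBrDr; apply: le_trans le_e; rewrite E lerD2r.
Qed.

(* Every other term of the coefficient of index i + j lies strictly higher, so
   that no cancellation can occur. *)
Lemma lowest_mul :
  (forall i' j', (i' + j' = i + j)%N -> (i', j') != (i, j) ->
     g`_i' != 0 -> h`_j' != 0 ->
     height p a b g i + height p a b h j <
     height p a b g i' + height p a b h j') ->
  lowest p a b (g * h) (i + j).
Proof.
move=> strict.
have lt_i : (i < (i + j).+1)%N by rewrite ltnS leq_addr.
have ij : (i + j - i = j)%N by rewrite addKn.
have gh0 : g`_i * h`_j != 0 by rewrite mulf_neq0 ?low_i.1 ?low_j.1.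
have [|t ti nz|sum0 sumE] :=
    @logn_sum_eq p _ (fun t : 'I_(i + j).+1 => g`_t * h`_(i + j - t)) (Ordinal lt_i) p_pr.
- by rewrite /= ij.
- rewrite /= ij; have := nz; rewrite mulf_eq0 negb_or => /andP[gt ht].
  have tij : (t + (i + j - t) = i + j)%N by have := ltn_ord t; lia.
  have ne : (t : nat, (i + j - t)%N) != (i, j).
    by apply: contra ti => /eqP[/eqP].
  have lt_h := strict _ _ tij ne gt ht; rewrite -ltz_nat -(ltr_pM2l b_gt0).
  by rewrite (logn_coefM p a b nz) (logn_coefM p a b gh0) tij ltrD2r.
rewrite -coefM in sum0 sumE.
split=> // s /height_mul_ge; apply: le_trans; rewrite [X in X <= _]/height sumE /= ij.
by rewrite (logn_coefM p a b gh0) addrK.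
Qed.
End Product.

(** * Leftmost and rightmost lowest points *)

Definition first_lowest (p : nat) (a b : int) (f : {poly int}) (i : nat) : Prop :=
  lowest p a b f i /\
  forall j, (j < i)%N -> f`_j != 0 -> height p a b f i < height p a b f j.

Definition last_lowest (p : nat) (a b : int) (f : {poly int}) (i : nat) : Prop :=
  lowest p a b f i /\
  forall j, (i < j)%N -> f`_j != 0 -> height p a b f i < height p a b f j.

Lemma ex_lowest (p : nat) (a b : int) (f : {poly int}) :
  f != 0 -> exists i, lowest p a b f i.
Proof.
rewrite -lead_coef_eq0 lead_coefE => lc0.
pose i0 := Ordinal (coef_neq0_lt_size lc0).
case: (arg_minP (fun i : 'I_(size f) => height p a b f i)
         (P := fun i : 'I_(size f) => f`_i != 0) (i0 := i0) lc0) => i fi mini.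
exists i; split=> // j fj.
exact: (mini (Ordinal (coef_neq0_lt_size fj))).
Qed.

Lemma ex_first_lowest (p : nat) (a b : int) (f : {poly int}) :
  f != 0 -> exists i, first_lowest p a b f i.
Proof.
move=> /(ex_lowest p a b)[i [fi mi]].
pose P j := (f`_j != 0) && (height p a b f j == height p a b f i).
have exP : exists j, P j by exists i; rewrite /P fi eqxx.
case: (ex_minnP exP) => j /andP[fj /eqP hj] minj; exists j.
split=> [|j' lt_j' fj']; first by split=> // j'; rewrite hj; exact: mi.
rewrite hj lt_neqAle mi // andbT eq_sym.
by apply/negP => hj'; move: (minj j'); rewrite /P fj' hj' leqNgt lt_j' => /(_ isT).
Qed.

Lemma ex_last_lowest (p : nat) (a b : int) (f : {poly int}) :
  f != 0 -> exists i, last_lowest p a b f i.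
Proof.
move=> /(ex_lowest p a b)[i [fi mi]].
pose P j := (f`_j != 0) && (height p a b f j == height p a b f i).
have exP : exists j, P j by exists i; rewrite /P fi eqxx.
have ubP j : P j -> (j <= size f)%N.
  by case/andP => /coef_neq0_lt_size/ltnW.
case: (ex_maxnP exP ubP) => j /andP[fj /eqP hj] maxj; exists j.
split=> [|j' lt_j' fj']; first by split=> // j'; rewrite hj; exact: mi.
rewrite hj lt_neqAle mi // andbT eq_sym.
by apply/negP => hj'; move: (maxj j'); rewrite /P fj' hj' leqNgt lt_j' => /(_ isT).
Qed.

(** Another pair with the same sum has [i' < i] or [j' < j], and there the height is strictly
    larger. *)
Lemma first_lowest_mul (p : nat) (a b : int) (g h : {poly int}) (i j : nat) :
  prime p -> 0 < b -> first_lowest p a b g i -> first_lowest p a b h j ->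
  lowest p a b (g * h) (i + j).
Proof.
move=> p_pr b_gt0 [li fi] [lj fj]; apply: lowest_mul => // i' j' ij ne gi hj.
have [lt_i|le_i] := ltnP i' i; first by rewrite ltr_leD ?fi // lj.2.
suff lt_j : (j' < j)%N by rewrite ler_ltD ?fj // li.2.
by move: ne; rewrite xpair_eqE; lia.
Qed.

Lemma last_lowest_mul (p : nat) (a b : int) (g h : {poly int}) (i j : nat) :
  prime p -> 0 < b -> last_lowest p a b g i -> last_lowest p a b h j ->
  lowest p a b (g * h) (i + j).
Proof.
move=> p_pr b_gt0 [li fi] [lj fj]; apply: lowest_mul => // i' j' ij ne gi hj.
have [lt_i|le_i] := ltnP i i'; first by rewrite ltr_leD ?fi // lj.2.
suff lt_j : (j < j')%N by rewrite ler_ltD ?fj // li.2.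
by move: ne; rewrite xpair_eqE; lia.
Qed.

(** * The degree as a sum of lengths of edges *)

Lemma dvdn_degree (p d : nat) (g : {poly int}) :
  g`_0 != 0 ->
  (forall (a b : int) i k, 0 < b -> coprimez a b -> (i < k)%N ->
     first_lowest p a b g i -> last_lowest p a b g k -> (d %| k - i)%N) ->
  (d %| (size g).-1)%N.
Proof.
move=> g0 edge; pose v i := (logn p `|g`_i|)%:Z.
(* Every chord ending at a vertex is less steep than every chord starting there. *)
pose vertex i := g`_i != 0 /\ forall j k, (j < i)%N -> (i < k)%N ->
  g`_j != 0 -> g`_k != 0 ->
  (v i - v j) * (k%:Z - i%:Z) < (v k - v i) * (i%:Z - j%:Z).
have gn0 : g != 0 by apply: contra_neq g0 => ->; rewrite coef0.
(* The degree is vacuously a vertex, no chord starting there. Strong induction then goes from each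
   vertex to the preceding one, down to 0. *)
suff dvd_vertex i : vertex i -> (d %| i)%N.
  apply: dvd_vertex; split=> [|j k _]; first by rewrite -lead_coefE lead_coef_eq0.
  by move=> lt_k _ /coef_neq0_lt_size; lia.
elim/ltn_ind: i => -[|i'] IH; first by rewrite dvdn0.
move: (i'.+1) (ltn0Sn i') IH => i i_gt0 IH [gi vi].
(* The steepest chord ending at [i] lies on the edge ending there; index 0 is a candidate because
   the constant coefficient is nonzero. *)
pose s (j : 'I_i) : rat := (v i - v j)%:~R / (i%:Z - j%:Z)%:~R.
case: (arg_maxP s (P := fun j : 'I_i => g`_j != 0) (i0 := Ordinal i_gt0) g0) => m gm maxm.
pose a := numq (s m); pose b := denq (s m).
have b_gt0 : 0 < b by exact: denq_gt0.
have co_ab : coprimez a b by rewrite coprimezE coprime_num_den.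
have lt_m := ltn_ord m.
have am : a * (i%:Z - m%:Z) = b * (v i - v m).
  apply: (@intr_inj rat); rewrite !intrM.
  have : a%:~R / b%:~R = (v i - v m)%:~R / (i%:Z - m%:Z)%:~R :> rat.
    by rewrite divq_num_den.
  by move/eqP; rewrite eqr_div ?intr_eq0; [move/eqP->; rewrite mulrC | lia..].
have left j : (j < i)%N -> g`_j != 0 -> b * (v i - v j) <= a * (i%:Z - j%:Z).
  move=> lt_j gj; have := maxm (Ordinal lt_j) gj.
  rewrite -[s m]divq_num_den /s /= ler_pdivrMr ?ltr0z; last by lia.
  by rewrite mulrAC ler_pdivlMr ?ltr0z // -!intrM ler_int mulrC.
(* The vertex property is applied to the chord from [m] to [i], of slope [a / b]. *)
have right k : (i < k)%N -> g`_k != 0 -> a * (k%:Z - i%:Z) < b * (v k - v i).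
  move=> lt_k gk; have mi : 0 < i%:Z - m%:Z by lia.
  rewrite -(ltr_pM2r mi) mulrAC am -!mulrA ltr_pM2l //.
  exact: vi.
have last_i : last_lowest p a b g i.
  split=> [|k lt_k gk]; last by have := right k lt_k gk; rewrite /height -/(v _) -/(v _); lia.
  split=> // j gj; rewrite /height -/(v _) -/(v _).
  case: (ltngtP j i) => [lt_j|gt_j|->//]; first by have := left j lt_j gj; lia.
  by have := right j gt_j gj; lia.
have [l first_l] := ex_first_lowest p a b gn0.
have hl := lowest_height first_l.1 last_i.1.
have hm : height p a b g m = height p a b g i.
  by rewrite /height -/(v _) -/(v _); lia.
(* The index [m] is lowest too, so [l <= m < i]. *)
have lt_li : (l < i)%N.
  rewrite (leq_ltn_trans _ lt_m) // leqNgt; apply/negP => lt_ml.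
  by have := first_l.2 _ lt_ml gm; rewrite hm hl ltxx.
rewrite -(subnK (ltnW lt_li)) dvdn_add //; first exact: edge first_l last_i.
(* The index [l] is a vertex: chords ending there have slope less than [a / b], those starting there
   at least [a / b]. *)
apply: IH => //; split=> [|j k lt_j lt_k gj gk]; first exact: first_l.1.1.
have := first_l.2 _ lt_j gj; have := first_l.1.2 _ gk.
rewrite /height -/(v _) -/(v _) -/(v _) => le_k lt_j'.
rewrite -(ltr_pM2l b_gt0) !mulrA.
have jl : 0 < l%:Z - j%:Z by lia.
have kl : 0 < k%:Z - l%:Z by lia.
apply: (@lt_le_trans _ _ (a * (l%:Z - j%:Z) * (k%:Z - l%:Z))).
  by rewrite ltr_pM2r //; lia.
by rewrite mulrAC ler_pM2r //; lia.
Qed.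

(** * Degrees of factors *)

Lemma width_gcd_dvdn_degree (R : realType) (p : nat) (g h : {poly int}) :
  prime p -> (g * h)`_0 != 0 -> (width_gcd R p (g * h) %| (size g).-1)%N.
Proof.
move=> p_pr; rewrite -horner_coef0 hornerM mulf_eq0 negb_or !horner_coef0.
move=> /andP[g0 h0]; apply: (dvdn_degree g0) => a b i k b_gt0 co_ab lt_ik fi lk.
have hn0 : h != 0 by apply: contra_neq h0 => ->; rewrite coef0.
have [j fj] := ex_first_lowest p a b hn0; have [l ll] := ex_last_lowest p a b hn0.
(* Even when [h] has a single lowest point, [j <= l] and [i < k] yield two distinct lowest indices
   of [g * h]. *)
have le_jl : (j <= l)%N.
  rewrite leqNgt; apply/negP => /fj.2 /(_ ll.1.1).
  by rewrite (lowest_height fj.1 ll.1) ltxx.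
have lt_ijkl : (i + j < k + l)%N by rewrite -addSn leq_add.
have := width_gcd_edge R b_gt0 lt_ijkl (first_lowest_mul p_pr b_gt0 fi fj)
  (last_lowest_mul p_pr b_gt0 lk ll) co_ab.
move=> /dvdn_trans; apply.
by have := dvdz_edge co_ab fi.1 lk.1; rewrite dvdzE subzn // ltnW.
Qed.

Theorem theoremB (R : realType) (f : {poly int}) (n k : nat) (p : 'I_k -> nat)
    (deg_f : size f = n.+1) (n_ge1 : (1 <= n)%N) (f0_neq0 : f.[0] != 0)
    (k_ge2 : (2 <= k)%N) (p_inj : injective p)
    (p_prime : forall i : 'I_k, prime (p i)) :
  let fQ : {poly rat} := map_poly intr f in
  let D : nat := \big[gcdn/0%N]_(i < k) (n %/ width_gcd R (p i) f)%N in
  (forall g : {poly rat}, g %| fQ -> (n %/ D %| (size g).-1)%N) /\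
  (D = 1%N -> irreducible_poly fQ).
Proof.
move=> fQ D; rewrite horner_coef0 in f0_neq0.
have dvd_deg i (g : {poly rat}) : g %| fQ -> (width_gcd R (p i) f %| (size g).-1)%N.
  (* By Gauss's lemma, a rational factor is a nonzero constant times an integer factor. *)
  case/dvdpP_rat_int => g' [c c0 ->] [h fE].
  rewrite size_scale // size_map_inj_poly //; last exact: intr_inj.
  by rewrite fE; apply: width_gcd_dvdn_degree; rewrite // -fE.
have size_fQ : size fQ = n.+1 by rewrite size_map_inj_poly //; exact: intr_inj.
have dvd_n i : (width_gcd R (p i) f %| n)%N.
  by have := dvd_deg i fQ (dvdpp _); rewrite size_fQ.
have dvd_D g : g %| fQ -> (n %/ D %| (size g).-1)%N.
  move=> /dvd_deg dvd_g; set m := (size g).-1 in dvd_g *.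
  have D_n : (D %| n)%N.
    (* One term of the gcd suffices, and each is a divisor of [n]. *)
    by apply: (@biggcdn_inf _ (Ordinal (ltnW k_ge2))) => //; exact: dvdn_div.
  have D_gt0 : (0 < D)%N by exact: dvdn_gt0 D_n.
  rewrite -(dvdn_pmul2r D_gt0) divnK //.
  (* [m * D] is the gcd of the products of [m] with the quotients of [n] by the width gcds; each
     product is a multiple of [n], since the width gcd divides [m]. *)
  rewrite (big_morph (muln m) (muln_gcdr m) (muln0 m)).
  apply/dvdn_biggcdP => i _; have /dvdnP[q ->] := dvd_g i.
  by rewrite -mulnA [(_ * (n %/ _))%N]mulnC divnK // dvdn_mull.
split=> // D1; split=> [|q q_neq1 q_f]; first by rewrite size_fQ ltnS.
have fQ0 : fQ != 0 by rewrite -size_poly_eq0 size_fQ.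
have q0 : (0 < size q)%N by rewrite size_poly_gt0; exact: dvdpN0 q_f fQ0.
(* It remains to see that [q] has full degree: its degree is positive and divisible by [n]. *)
rewrite -dvdp_size_eqp // size_fQ eqn_leq -{1}size_fQ dvdp_leq //=.
have := dvd_D _ q_f; rewrite D1 divn1.
by case: (size q) q_neq1 q0 => [|[|s]] // _ _ /dvdn_leq; apply.
Qed.
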